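(* Let $\mathcal{A}$ be an orthogonal array $\mathrm{OA}(2,n,k)$, with symbols written as $1,2,\ldots,k$, and let $r$ be an integer with $1\le r<n-1$. Let $\mathcal{S}$ be the system on $\mathbb{Z}_2^{rk}\times\mathbb{Z}_{k+1}^{n-r}$ whose blocks (codewords) are: (1) for each $i$ with $0\le i\le r-1$, the word with ones exactly in the binary coordinates $ik+1,ik+2,\ldots,ik+k$ and $0$ in all other coordinates; and (2) for each row $(j_1,j_2,\ldots,j_n)$ of $\mathcal{A}$, the word whose ones among the first $rk$ binary coordinates are exactly in the positions $j_1,\,k+j_2,\,\ldots,\,(r-1)k+j_r$ and whose coordinates $rk+1,rk+2,\ldots,rk+n-r$ are the letters $j_{r+1},j_{r+2},\ldots,j_n\in\mathbb{Z}_{k+1}$, respectively. Then $\mathcal{S}$ is an $\mathrm{MS}_d(2,k,\mathbb{Z}_2^{rk}\times\mathbb{Z}_{k+1}^{n-r})$, where $d=n+r-2$.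
   Context: An orthogonal array $\mathrm{OA}(2,n,k)$ is a $k^2\times n$ array over an alphabet of $k$ symbols such that in the projection onto any two columns each ordered pair of symbols appears exactly once. For $Q=\mathbb{Z}_{q_1}\times\cdots\times\mathbb{Z}_{q_N}$, viewed as the set of words of length $N$ whose $i$-th letter lies in $\mathbb{Z}_{q_i}$, the weight of a word is its number of nonzero coordinates, and $d(\cdot,\cdot)$ is the Hamming distance. $\mathbb{Z}_2^{m}\times\mathbb{Z}_q^{s}$ has $m$ binary coordinates (indexed $1,\dots,m$) followed by $s$ coordinates over $\mathbb{Z}_q$ (indexed $m+1,\dots,m+s$). A mixed Steiner system $\mathrm{MS}(t,k,Q)$ is a pair $(Q,\mathcal{C})$, where $\mathcal{C}$ is a set of words (codewords) of $Q$ of weight $k$ such that for every word $x\in Q$ of weight $t$ there is exactly one codeword $c\in\mathcal{C}$ with $d(x,c)=k-t$, and the minimum Hamming distance of $\mathcal{C}$ is $2(k-t)+1$. When the minimum distance is different, i.e., smaller, from $2(k-t)+1$ (the other requirements being unchanged), the system is denoted by $\mathrm{MS}_d(t,k,Q)$, where $d$ is the minimum Hamming distance of the system.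
   Formalization: The formal theorem adds the hypothesis n = k: words from rows of the array have weight n while all codewords must have weight k, so the claim fails whenever n ≠ k (e.g. OA(2,3,2) with r = 1 gives row words of weight 3 instead of 2). *)

(* Defs.v *)
From mathcomp Require Import all_boot all_algebra.
Set Implicit Arguments.
Unset Strict Implicit.
Unset Printing Implicit Defensive.

(* Z_{q_0} x ... x Z_{q_(N-1)}; only the zero letter (value 0) and equality of
   letters matter, so Z_q is taken to be 'I_q.  Unlike 'Z_q this has exactly q
   elements for every q. *)
Definition word (N : nat) (q : 'I_N -> nat) : finType :=
  {dffun forall i : 'I_N, 'I_(q i)}.

Definition weight (N : nat) (q : 'I_N -> nat) (w : word q) : nat :=
  #|[set i : 'I_N | (w i : nat) != 0]|.

Definition dist (N : nat) (q : 'I_N -> nat) (x y : word q) : nat :=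
  #|[set i : 'I_N | x i != y i]|.

Definition has_min_dist (N : nat) (q : 'I_N -> nat) (C : {set word q})
    (d : nat) : Prop :=
  (exists x y, [/\ x \in C, y \in C, x != y & dist x y = d]) /\
  (forall x y, x \in C -> y \in C -> x != y -> d <= dist x y).

(* MS_d(t, k, Q): all the requirements of a mixed Steiner system MS(t, k, Q),
   except that the minimum distance d is smaller than 2 (k - t) + 1. *)
Definition is_MSd (d t k N : nat) (q : 'I_N -> nat) (C : {set word q}) : Prop :=
  [/\ forall c, c \in C -> weight c = k,
      forall x : word q, weight x = t ->
        exists! c, c \in C /\ dist x c = k - t,
      has_min_dist C d
    & d < 2 * (k - t) + 1].

(* The alphabet sizes of Z_2^m x Z_p^s. *)
Definition mixq (m s p : nat) (i : 'I_(m + s)) : nat :=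
  match split i with inl _ => 2 | inr _ => p end.

Arguments mixq : clear implicits.

Definition mixword (m s p : nat) (b : 'I_m -> bool) (l : 'I_s -> 'I_p) :
    word (mixq m s p) :=
  [ffun i => match split i as u
               return 'I_(match u with inl _ => 2 | inr _ => p end) with
             | inl x => if b x then ord_max else ord0
             | inr y => l y
             end].

(* OA(2, n, k).  The symbol written j in 1..k is the element of 'I_k of value
   j - 1. *)
Definition orthogonal_array (n k : nat) (A : 'M['I_k]_(k ^ 2, n)) : Prop :=
  forall c1 c2 : 'I_n, c1 != c2 ->
  forall a b : 'I_k, exists! s : 'I_(k ^ 2), A s c1 = a /\ A s c2 = b.

Lemma tail_col_subproof (n r : nat) (l : 'I_(n - r)) : r + l < n.
Proof. by rewrite -ltn_subRL. Qed.

Definition tail_col (n r : nat) (l : 'I_(n - r)) : 'I_n :=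
  Ordinal (tail_col_subproof l).

(* Coordinates are numbered from 0: the binary positions i k + 1, ..., i k + k
   are i k, ..., i k + k - 1 here. *)
Definition group_word (n k r : nat) (i : 'I_r) :
    word (mixq (r * k) (n - r) k.+1) :=
  mixword (fun p : 'I_(r * k) => i * k <= p < i * k + k)
          (fun _ : 'I_(n - r) => ord0).

(* With symbols and coordinates both shifted by one, the binary position
   i k + j_(i+1) is i * k + A s i, and lift ord0 (A s c) is the letter j of
   Z_(k+1), of value (A s c).+1. *)
Definition row_word (n k r : nat) (A : 'M['I_k]_(k ^ 2, n)) (s : 'I_(k ^ 2)) :
    word (mixq (r * k) (n - r) k.+1) :=
  mixword
    (fun p : 'I_(r * k) =>
       [exists i : 'I_n, (i < r) && (p == i * k + A s i :> nat)])
    (fun l : 'I_(n - r) => lift ord0 (A s (tail_col l))).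

Definition OA_system (n k r : nat) (A : 'M['I_k]_(k ^ 2, n)) :
    {set word (mixq (r * k) (n - r) k.+1)} :=
  [set group_word n k i | i : 'I_r] :|: [set row_word r A s | s : 'I_(k ^ 2)].

(* Main.v *)
(** The support of a word splits into points: a coordinate together with its
    letter determines a column [c] of the array and a symbol [a].  A row word
    contains the point exactly when the row has [a] in column [c], and a group
    word exactly when its index is [c].  A word of weight 2 gives two points;
    if they share their column they lie in one group word and in no row word,
    otherwise the array provides the unique row word containing both.
    Distances come from
    [dist x y + #agreements + #common support = weight x + weight y],
    together with the fact that two rows agree in at most one column. *)
Require Import Defs.
From mathcomp Require Import all_boot all_algebra.
From mathcomp Require Import zify.

Set Implicit Arguments.
Unset Strict Implicit.
Unset Printing Implicit Defensive.

(** * Supports, agreements and Hamming distance *)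

Definition supp (N : nat) (q : 'I_N -> nat) (x : word q) : {set 'I_N} :=
  [set i | (x i : nat) != 0].

Definition agree (N : nat) (q : 'I_N -> nat) (x y : word q) : {set 'I_N} :=
  [set i in supp x | (x i : nat) == y i].

Lemma agree_sub (N : nat) (q : 'I_N -> nat) (x y : word q) :
  agree x y \subset supp x :&: supp y.
Proof.
by apply/subsetP => i; rewrite !inE => /andP[xi0 /eqP <-]; rewrite xi0.
Qed.

(** Double counting, one coordinate at a time. A coordinate in both supports contributes 2 to the
    right side, and on the left 1 to the common support plus 1 to either [dist] or [agree]; a
    coordinate in exactly one support contributes 1 to [dist] only. *)
Lemma dist_agree (N : nat) (q : 'I_N -> nat) (x y : word q) :
  dist x y + #|agree x y| + #|supp x :&: supp y| = weight x + weight y.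
Proof.
have cE (P : pred 'I_N) : #|[set i | P i]| = \sum_(i < N) P i.
  by rewrite cardsE -sum1_card big_mkcond.
have -> : agree x y = [set i | ((x i : nat) != 0) && ((x i : nat) == y i)].
  by apply/setP => i; rewrite !inE.
have -> : supp x :&: supp y =
    [set i | ((x i : nat) != 0) && ((y i : nat) != 0)].
  by apply/setP => i; rewrite !inE.
rewrite /dist /weight !cE -!big_split /=; apply: eq_bigr => i _.
rewrite -val_eqE /=; lia.
Qed.

(** Turns the distance condition of a Steiner system into containment. By [dist_agree] the distance
    is [weight y - weight x] exactly when agreements and common support add up to twice [weight x];
    each is at most [weight x], so [agree x y] must fill [supp x]. *)
Lemma dist_eq_subB (N : nat) (q : 'I_N -> nat) (x y : word q) :
  weight x <= weight y ->
  (dist x y = weight y - weight x <-> {in supp x, forall i, x i = y i :> nat}).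
Proof.
move=> le_xy; have dE := dist_agree x y.
have leA := subset_leq_card (agree_sub x y).
have leI := subset_leq_card (subsetIl (supp x) (supp y)).
have wE : weight x = #|supp x| by [].
have sA : agree x y \subset supp x.
  exact: subset_trans (agree_sub x y) (subsetIl _ _).
split=> [dxy i | xy].
  have /eqP <- : agree x y == supp x by rewrite eqEcard sA; lia.
  by rewrite inE => /andP[_ /eqP].
have AE : agree x y = supp x.
  by apply/setP => i; rewrite inE andb_idr // => /xy/eqP.
rewrite AE in dE leA; lia.
Qed.

(** * Coordinates as points, and the values of the blocks there *)

Lemma mixwordE (m s p : nat) (b : 'I_m -> bool) (l : 'I_s -> 'I_p) i :
  mixword b l i =
    match split i with inl x => nat_of_bool (b x) | inr y => nat_of_ord (l y) end
    :> nat.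
Proof. by rewrite ffunE /mixq; case: (split i) => // x; case: (b x). Qed.

Lemma mulDr_lt (k r c a : nat) : c < r -> a < k -> c * k + a < r * k.
Proof.
by move=> cr ak; apply: (@leq_trans (c.+1 * k)); rewrite ?leq_mul //; lia.
Qed.

Lemma pos_subproof (n k r : nat) (c : 'I_n) (a : 'I_k) :
  (if c < r then c * k + a else r * k + (c - r)) < r * k + (n - r).
Proof.
have [cn ak] := (ltn_ord c, ltn_ord a).
by have [cr | rc] := ltnP c r; [have := mulDr_lt cr ak | ]; lia.
Qed.

(* The symbol [a] is irrelevant for [r <= c], where the coordinate is the whole
   letter of column [c]. *)
Definition pos (n k r : nat) (c : 'I_n) (a : 'I_k) : 'I_(r * k + (n - r)) :=
  Ordinal (pos_subproof r c a).

Lemma divn_mulDr (k c a : nat) : a < k -> (c * k + a) %/ k = c.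
Proof. by move=> ak; rewrite divnMDl ?divn_small ?addn0 //; lia. Qed.

Lemma mulDr_inj (k c c' a a' : nat) : a < k -> a' < k ->
  c * k + a = c' * k + a' -> c = c' /\ a = a'.
Proof.
move=> ak a'k E; suff cc' : c = c' by subst c'; lia.
by rewrite -(divn_mulDr c ak) E divn_mulDr.
Qed.

Lemma pos_inj (n k r : nat) (c c' : 'I_n) (a a' : 'I_k) :
  pos r c a = pos r c' a' -> c = c' /\ (c < r -> a = a').
Proof.
move/(congr1 val) => /=.
have [ak a'k] := (ltn_ord a, ltn_ord a').
case: ltnP => cr; case: ltnP => c'r E.
- by have [/ord_inj -> /ord_inj ->] := mulDr_inj ak a'k E.
- by have := mulDr_lt cr ak; lia.
- by have := mulDr_lt c'r a'k; lia.
- by split; [apply: ord_inj; lia | lia].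
Qed.

(** Binary coordinates split by division by [k]. A tail coordinate leaves the symbol free, and [b]
    lets the caller prescribe it; where it does not matter any available symbol is passed. *)
Lemma pos_surj (n k r : nat) (i : 'I_(r * k + (n - r))) (b : 'I_k) :
  r < n -> exists c a, i = pos r c a /\ (r <= c -> a = b :> 'I_k).
Proof.
move=> rn; have [ik | ki] := ltnP i (r * k).
  have k0 : 0 < k by have := ltn_ord b; lia.
  have cr : i %/ k < r by rewrite ltn_divLR.
  exists (Ordinal (ltn_trans cr rn)), (Ordinal (ltn_pmod i k0)); split=> /=.
    by apply: val_inj; rewrite /= cr -divn_eq.
  by rewrite leqNgt cr.
have cn : r + (i - r * k) < n by have := ltn_ord i; lia.
exists (Ordinal cn), b; split=> //.
by apply: val_inj; rewrite /= ltnNge leq_addr /= addKn subnKC.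
Qed.

(** In the binary part the existential over columns collapses to [c], because quotient and remainder
    by [k] recover column and symbol. *)
Lemma row_word_pos (n k r : nat) (A : 'M['I_k]_(k ^ 2, n)) s c a :
  row_word r A s (pos r c a) =
    (if c < r then nat_of_bool (a == A s c) else (A s c).+1) :> nat.
Proof.
rewrite mixwordE; case: splitP => [p | l] /=.
  case: ltnP => [cr pE | rc pE]; last by have := ltn_ord p; lia.
  congr nat_of_bool; apply/idP/eqP => [/existsP[i /andP[ir]] | aE].
    rewrite -pE => /eqP E.
    have [/ord_inj -> aE] := mulDr_inj (ltn_ord a) (ltn_ord (A s i)) E.
    exact: ord_inj.
  by apply/existsP; exists c; rewrite cr -pE aE eqxx.
case: ltnP => [cr E | rc E]; first by have := mulDr_lt cr (ltn_ord a); lia.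
rewrite /bump leq0n add1n; congr (A s _).+1.
by apply: ord_inj => /=; lia.
Qed.

Lemma group_word_pos (n k r : nat) (g : 'I_r) (c : 'I_n) (a : 'I_k) :
  group_word n k g (pos r c a) = ((c : nat) == g) :> nat.
Proof.
have [gr ak] := (ltn_ord g, ltn_ord a).
rewrite mixwordE; case: splitP => [p | l] /=; last first.
  by case: ltnP => [cr | rc] E; [have := mulDr_lt cr ak | ]; lia.
case: ltnP => [cr pE | rc pE]; last by have := ltn_ord p; lia.
rewrite -pE; congr nat_of_bool; apply/idP/eqP => [|->]; last by lia.
nia.
Qed.

(** * Supports and weights of the blocks *)

Lemma supp_row_word (n k r : nat) (A : 'M['I_k]_(k ^ 2, n)) s : r < n ->
  supp (row_word r A s) = [set pos r c (A s c) | c : 'I_n].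
Proof.
move=> rn; apply/setP => i; rewrite inE; apply/idP/imsetP => [|[c _ ->]].
  have [c [a [-> _]]] := pos_surj i (A s (Ordinal rn)) rn.
  rewrite row_word_pos; have [cr | rc _] := ltnP c r.
    by case: (a =P A s c) => [-> _ | //]; exists c.
  by exists c => //; apply: val_inj; rewrite /= ltnNge rc.
by rewrite row_word_pos; case: ifP => //; rewrite eqxx.
Qed.

Lemma pos_row_inj (n k r : nat) (A : 'M['I_k]_(k ^ 2, n)) s :
  injective (fun c => pos r c (A s c)).
Proof. by move=> c c' /pos_inj[]. Qed.

Lemma weight_row_word (n k r : nat) (A : 'M['I_k]_(k ^ 2, n)) s : r < n ->
  weight (row_word r A s) = n.
Proof.
move=> rn; rewrite /weight -/(supp _) supp_row_word // card_imset.
  exact: card_ord.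
exact: pos_row_inj.
Qed.

Lemma supp_group_word (n k r : nat) (rn : r < n) (g : 'I_r) : 0 < k ->
  supp (group_word n k g) =
    [set pos r (widen_ord (ltnW rn) g) a | a : 'I_k].
Proof.
move=> k0; apply/setP => i; rewrite inE; apply/idP/imsetP => [|[a _ ->]].
  have [c [a [-> _]]] := pos_surj i (Ordinal k0) rn.
  rewrite group_word_pos; case: (c =P g :> nat) => // cg _; exists a => //.
  by congr pos; apply: ord_inj.
by rewrite group_word_pos eqxx.
Qed.

Lemma weight_group_word (n k r : nat) (g : 'I_r) : r < n -> 0 < k ->
  weight (group_word n k g) = k.
Proof.
move=> rn k0; rewrite /weight -/(supp _) (supp_group_word rn) // card_imset.
  exact: card_ord.
by move=> a a' /pos_inj[_ /(_ (ltn_ord g))].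
Qed.

(** * Intersections and distances of blocks *)

Lemma supp_row_group (n k r : nat) (A : 'M['I_k]_(k ^ 2, n)) s (g : 'I_r)
    (rn : r < n) :
  supp (row_word r A s) :&: supp (group_word n k g) =
    [set pos r (widen_ord (ltnW rn) g) (A s (widen_ord (ltnW rn) g))].
Proof.
apply/setP => i; rewrite !inE; apply/andP/eqP => [[+ +] | ->].
  have [c [a [-> _]]] := pos_surj i (A s (Ordinal rn)) rn.
  rewrite row_word_pos group_word_pos; case: (c =P g :> nat) => // cg.
  rewrite cg ltn_ord; case: (a =P A s c) => [-> _ _ | //].
  by have -> : c = widen_ord (ltnW rn) g by apply: ord_inj.
by rewrite row_word_pos group_word_pos /= ltn_ord !eqxx.
Qed.

(** The supports meet in one coordinate, which lowers the sum of weights [n + k] by at most 2. *)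
Lemma dist_row_group (n k r : nat) (A : 'M['I_k]_(k ^ 2, n)) s (g : 'I_r) :
  r < n -> n + k - 2 <= dist (row_word r A s) (group_word n k g).
Proof.
move=> rn; have k0 : 0 < k := leq_ltn_trans (leq0n _) (ltn_ord (A s (Ordinal rn))).
have := dist_agree (row_word r A s) (group_word n k g).
have := subset_leq_card (agree_sub (row_word r A s) (group_word n k g)).
rewrite (supp_row_group A s g rn) cards1 weight_row_word // weight_group_word //.
lia.
Qed.

Lemma dist_group_group (n k r : nat) (g h : 'I_r) : r < n -> 0 < k -> g != h ->
  dist (group_word n k g) (group_word n k h) = k + k.
Proof.
move=> rn k0 gh.
have := dist_agree (group_word n k g) (group_word n k h).
have := subset_leq_card (agree_sub (group_word n k g) (group_word n k h)).
have -> : supp (group_word n k g) :&: supp (group_word n k h) = set0.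
  apply/setP => i; rewrite !inE.
  have [c [a [-> _]]] := pos_surj i (Ordinal k0) rn.
  rewrite !group_word_pos; case: (c =P g :> nat) => // ->.
  by rewrite val_eqE (negPf gh).
by rewrite cards0 !weight_group_word //; lia.
Qed.

Definition row_agree (n k : nat) (A : 'M['I_k]_(k ^ 2, n)) s t : {set 'I_n} :=
  [set c | A s c == A t c].

(** Rows agreeing in two columns would show the same ordered pair of symbols there, against
    uniqueness in the array. *)
Lemma row_agree_le1 (n k : nat) (A : 'M['I_k]_(k ^ 2, n)) s t :
  orthogonal_array A -> s != t -> #|row_agree A s t| <= 1.
Proof.
move=> hA st; apply/card_le1_eqP => c c'; rewrite !inE => /eqP cE /eqP c'E.
apply/eqP; apply: contraNT st => cc'.
have [u [_ uniq_u]] := hA _ _ cc' (A s c') (A s c).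
by rewrite -(uniq_u s) // -(uniq_u t).
Qed.

Lemma agree_row_row (n k r : nat) (A : 'M['I_k]_(k ^ 2, n)) s t : r < n ->
  agree (row_word r A s) (row_word r A t) =
    [set pos r c (A s c) | c in row_agree A s t].
Proof.
move=> rn; apply/setP => i; rewrite inE supp_row_word //.
apply/andP/imsetP => [[/imsetP[c _ ->]] | [c]].
  rewrite !row_word_pos => E; exists c => //; rewrite inE.
  move: E; case: ifP => _; first by rewrite eqxx; case: (A s c == A t c).
  by rewrite eqSS val_eqE.
rewrite inE => /eqP E ->; split; first exact: imset_f.
by rewrite !row_word_pos E.
Qed.

(** Tail letters of row words are never zero, so every tail column contributes; in a binary column
    the ones coincide only if the rows agree. *)
Lemma supp_row_row (n k r : nat) (A : 'M['I_k]_(k ^ 2, n)) s t : r < n ->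
  supp (row_word r A s) :&: supp (row_word r A t) =
    [set pos r c (A s c) | c in [set c : 'I_n | r <= c] :|: row_agree A s t].
Proof.
move=> rn; apply/setP => i; rewrite inE supp_row_word // [i \in supp _]inE.
apply/andP/imsetP => [[/imsetP[c _ ->]] | [c + ->]].
  rewrite row_word_pos => E; exists c => //; rewrite !inE.
  by move: E; case: ltnP => //= _; rewrite eqb0 negbK.
rewrite !inE row_word_pos => E; split; first exact: imset_f.
by move: E; case: ltnP => //= _ ->.
Qed.

Lemma card_tail (n r : nat) : #|[set c : 'I_n | r <= c]| = n - r.
Proof.
rewrite cardsE -sum1_card big_mkcond /=.
have -> : \sum_(c < n) (if c \in [pred c : 'I_n | r <= c] then 1 else 0) =
    \sum_(c < n) nat_of_bool (r <= c).
  by apply: eq_bigr => c _; rewrite inE; case: (r <= c).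
by elim: n => [|n IHn]; rewrite ?big_ord0 ?big_ord_recr /= ?IHn; lia.
Qed.

(** An agreement in a binary column costs 2, since it also enlarges the union; in a tail column it
    costs only 1. *)
Lemma dist_row_row (n k r : nat) (A : 'M['I_k]_(k ^ 2, n)) s t : r < n ->
  dist (row_word r A s) (row_word r A t) + #|row_agree A s t|
    + #|[set c : 'I_n | r <= c] :|: row_agree A s t| = n + n.
Proof.
move=> rn; have := dist_agree (row_word r A s) (row_word r A t).
rewrite agree_row_row // supp_row_row // !weight_row_word // !card_imset //;
  exact: pos_row_inj.
Qed.

(** * Covering of the words of weight 2 *)

Lemma supp_point (n k r : nat) (x : word (mixq (r * k) (n - r) k.+1)) i :
  r < n -> i \in supp x ->
  exists (c : 'I_n) (a : 'I_k),
    i = pos r c a /\ x i = (if c < r then 1 else a.+1) :> nat.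
Proof.
move=> rn; rewrite inE; case: (x i) => v v_lt /= v0.
(* The alphabet size is exposed as a case on [split i], so that [splitP] settles it together with
   the kind of coordinate. *)
have {v_lt} : v < (if split i is inl _ then 2 else k.+1) := v_lt.
case: splitP => [p ip | l il] v_lt.
  have pk := ltn_ord p.
  have k0 : 0 < k by have := leq_ltn_trans (leq0n _) pk; rewrite muln_gt0 => /andP[].
  have [c [a [iE _]]] := pos_surj i (Ordinal k0) rn.
  exists c, a; split=> //; move/(congr1 val): iE => /=.
  by case: ltnP => [cr | rc] iE; lia.
have ak : v.-1 < k by lia.
(* The free symbol is taken to be the letter of [x], shifted down by one. *)
have [c [a [iE aE]]] := pos_surj i (Ordinal ak) rn.
exists c, a; split=> //; move/(congr1 val): iE => /=.
case: ltnP => [cr | rc] iE; first by have := mulDr_lt cr (ltn_ord a); lia.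
by rewrite aE //= prednK // lt0n.
Qed.

Lemma OA_system_cover (n k r : nat) (A : 'M['I_k]_(k ^ 2, n))
    (x : word (mixq (r * k) (n - r) k.+1)) :
  orthogonal_array A -> r < n -> weight x = 2 ->
  exists! c, c \in OA_system r A /\ {in supp x, forall i, x i = c i :> nat}.
Proof.
move=> hA rn wx; have /eqP/cards2P[i [j [ij xE]]] : #|supp x| = 2 := wx.
have covE (y : word _) : {in supp x, forall i, x i = y i :> nat} <->
    x i = y i :> nat /\ x j = y j :> nat.
  rewrite xE; split=> [xy | [xi xj] l]; first by rewrite !xy ?inE ?eqxx ?orbT.
  by rewrite !inE => /orP[] /eqP->.
have [c [a [iE xi]]] : exists (c : 'I_n) (a : 'I_k),
    i = pos r c a /\ x i = (if c < r then 1 else a.+1) :> nat.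
  by apply: supp_point => //; rewrite xE !inE eqxx.
have [d [b [jE xj]]] : exists (c : 'I_n) (a : 'I_k),
    j = pos r c a /\ x j = (if c < r then 1 else a.+1) :> nat.
  by apply: supp_point => //; rewrite xE !inE eqxx orbT.
have rowE (l : 'I__) (e : 'I_n) (f : 'I_k) s :
    l = pos r e f -> x l = (if e < r then 1 else f.+1) :> nat ->
    (x l = row_word r A s l :> nat) <-> A s e = f.
  move=> lE ->; rewrite lE row_word_pos.
  case: ifP => _; first by case: eqP => [->|] //; split=> // /esym.
  by split=> [[/ord_inj->] | ->].
have groupE (l : 'I__) (e : 'I_n) (f : 'I_k) (g : 'I_r) :
    l = pos r e f -> x l = (if e < r then 1 else f.+1) :> nat ->
    (x l = group_word n k g l :> nat) <-> e = g :> nat.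
  move=> lE ->; rewrite lE group_word_pos.
  by case: ltnP => er; case: eqP => // eg; have := ltn_ord g; lia.
have [cd | cd] := eqVneq c d.
  (* A tail column has a single coordinate, so two distinct points in one column force it to be
     binary. *)
  have cr : c < r.
    rewrite ltnNge; apply: contraNN ij => rc; rewrite iE jE -cd.
    by apply/eqP/val_inj; rewrite /= ltnNge rc.
  exists (group_word n k (Ordinal cr)); split.
    split; first by rewrite !inE imset_f.
    by apply/covE; rewrite (groupE _ _ _ _ iE xi) (groupE _ _ _ _ jE xj) -cd.
  move=> y [+ /covE[yi yj]]; rewrite inE => /orP[] /imsetP[t _ yE].
    have /(groupE _ _ _ _ iE xi) ct : x i = group_word n k t i :> nat by rewrite -yE.
    by rewrite yE; congr group_word; apply: ord_inj.
  have /(rowE _ _ _ _ iE xi) ca : x i = row_word r A t i :> nat by rewrite -yE.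
  have /(rowE _ _ _ _ jE xj) db : x j = row_word r A t j :> nat by rewrite -yE.
  (* A row has one symbol per column, so a row word containing both points would make them equal. *)
  have E : pos r c (A t c) = pos r d (A t d) by rewrite cd.
  by move: ij; rewrite iE jE -ca -db E eqxx.
have [s [[sc sd] uniq_s]] := hA _ _ cd a b.
exists (row_word r A s); split.
  split; first by rewrite !inE [X in _ || X]imset_f ?orbT.
  by apply/covE; rewrite (rowE _ _ _ _ iE xi) (rowE _ _ _ _ jE xj).
move=> y [+ /covE[yi yj]]; rewrite inE => /orP[] /imsetP[t _ yE].
  have /(groupE _ _ _ _ iE xi) ct : x i = group_word n k t i :> nat by rewrite -yE.
  have /(groupE _ _ _ _ jE xj) dt : x j = group_word n k t j :> nat by rewrite -yE.
  by case/eqP: cd; apply: ord_inj; rewrite ct dt.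
have /(rowE _ _ _ _ iE xi) ca : x i = row_word r A t i :> nat by rewrite -yE.
have /(rowE _ _ _ _ jE xj) db : x j = row_word r A t j :> nat by rewrite -yE.
by rewrite yE (uniq_s t).
Qed.

(** * Minimum distance and conclusion *)

Lemma distC (N : nat) (q : 'I_N -> nat) (x y : word q) : dist x y = dist y x.
Proof. by apply: eq_card => i; rewrite !inE eq_sym. Qed.

Lemma distxx (N : nat) (q : 'I_N -> nat) (x : word q) : dist x x = 0.
Proof. by apply: eq_card0 => i; rewrite !inE eqxx. Qed.

Lemma OA_system_min_dist (n k r : nat) (A : 'M['I_k]_(k ^ 2, n)) :
  orthogonal_array A -> 0 < r < n -> 1 < k -> n <= k ->
  has_min_dist (OA_system r A) (n + r - 2).
Proof.
move=> hA /andP[r0 rn] k1 nk; have k0 := ltnW k1.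
have rowT s : row_word r A s \in OA_system r A.
  by rewrite inE [X in _ || X]imset_f ?orbT.
split; last first.
  move=> x y; rewrite !inE.
  case/orP=> /imsetP[g _ ->]; case/orP=> /imsetP[h _ ->] neq.
  - rewrite dist_group_group //; first by lia.
    by apply: contraNneq neq => ->.
  - by rewrite distC; apply: leq_trans (dist_row_group A h g rn); lia.
  - by apply: leq_trans (dist_row_group A g h rn); lia.
  have gh : g != h by apply: contraNneq neq => ->.
  have := dist_row_row A g h rn; have := row_agree_le1 hA gh.
  have [+ _] := leq_card_setU [set c : 'I_n | r <= c] (row_agree A g h).
  by rewrite card_tail /reverse_coercion; lia.
have n0 : 0 < n by lia.
have n1 : 1 < n by lia.
pose c0 := Ordinal n0; pose c1 := Ordinal n1.
have c01 : c0 != c1 by [].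
(* Rows with equal symbols in column [c0] and different ones in [c1] agree in [c0] alone. As
   [0 < r], this column is binary, so the agreement costs 2 and the lower bound is attained. *)
have [s [[s0 s1] _]] := hA _ _ c01 (Ordinal k0) (Ordinal k0).
have [t [[t0 t1] _]] := hA _ _ c01 (Ordinal k0) (Ordinal k1).
have st : s != t by apply/eqP => st; move: t1; rewrite -st s1 => /(congr1 val).
have dst : dist (row_word r A s) (row_word r A t) = n + r - 2.
  have := dist_row_row A s t rn.
  have -> : row_agree A s t = [set c0].
    apply/eqP; rewrite eq_sym eqEcard sub1set inE s0 t0 eqxx cards1.
    exact: row_agree_le1.
  rewrite setUC cardsU1 cards1 card_tail inE leqNgt r0; lia.
exists (row_word r A s), (row_word r A t); split=> //.
apply/eqP => E; move: dst; rewrite E distxx; lia.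
Qed.

Theorem theorem15 (n k r : nat) (A : 'M['I_k]_(k ^ 2, n))
    (hA : orthogonal_array A) (hr1 : 1 <= r) (hrn : r < n - 1) (hnk : n = k) :
  is_MSd (n + r - 2) 2 k (OA_system r A).
Proof.
have rn : r < n by lia.
have k0 : 0 < k by lia.
(* Group words have weight [k] and row words weight [n]; [hnk] equates the two. *)
have wC c : c \in OA_system r A -> weight c = k.
  rewrite inE => /orP[] /imsetP[i _ ->]; first exact: weight_group_word.
  by rewrite weight_row_word.
(* The strict bound on the distance amounts to [r < n - 1], as [n = k]. *)
split=> //; [move=> x wx | by apply: (OA_system_min_dist hA); lia | by lia].
have coverP c : c \in OA_system r A ->
    dist x c = k - 2 <-> {in supp x, forall i, x i = c i :> nat}.
  move=> /wC wc; have le_xc : weight x <= weight c by lia.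
  by have := dist_eq_subB le_xc; rewrite wc wx.
have [c [[cC xc] uniq_c]] := OA_system_cover hA rn wx.
exists c; split; first by split=> //; apply/coverP.
by move=> y [yC dxy]; apply: uniq_c; split=> //; apply/coverP.
Qed.
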